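(* Let $r\geq 1$, $n\geq 1$ and $1\leq k\leq rn$ be integers. Then $$E^*(\mathcal{B}^{(r)}_{n,k},z)=\sum_{\substack{(\sigma,c)\in\mathfrak{S}^{(r)}_n\\ \mathrm{fexc}(\sigma,c)=rn-k}} z^{\lceil \mathrm{fdes}^*(\sigma,c)/r\rceil}.$$
   Context: Ehrhart series: for $\mathcal{X}\subset\mathbb{R}^n$ (here a convex integral polytope with possibly some faces removed), $E(\mathcal{X},t)$ denotes the polynomial in $t$ such that $E(\mathcal{X},t)=\#(t\mathcal{X}\cap\mathbb{Z}^n)$ for every integer $t>0$, where $t\mathcal{X}=\{tx: x\in\mathcal{X}\}$; and $E^*(\mathcal{X},z):=(1-z)^{n+1}\sum_{t\geq 0}E(\mathcal{X},t)z^t$ (the value at $t=0$ is that of the polynomial). Multi-hypersimplices: for $1\le k<rn$, $\mathcal{B}^{(r)}_{n,k}=\{v\in[0,r]^n : k-1\leq\sum_i v_i<k\}$; for $k=rn$, $\mathcal{B}^{(r)}_{n,k}=\{v\in[0,r]^n : k-1\leq\sum_i v_i\leq k\}$. Colored permutations: $\mathfrak{S}_n^{(r)}$ is the set of pairs $(\sigma,c)$ with $\sigma\in\mathfrak{S}_n$ a permutation of $\{1,\dots,n\}$ and $c=(c_1,\dots,c_n)\in\{0,1,\dots,r-1\}^n$. Define $\mathrm{fexc}(\sigma,c)=r\cdot\#\{i\in\{1,\dots,n\}:\sigma_i>i\text{ and }c_i=0\}+\sum_{i=1}^n c_i$; $\mathrm{des}^*(\sigma,c)=\#\{i : 1\leq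 i\leq n-1,\ c_i<c_{i+1}\text{, or }c_i=c_{i+1}\text{ and }\sigma_i>\sigma_{i+1}\}$; $\mathrm{fdes}^*(\sigma,c)=r\cdot\mathrm{des}^*(\sigma,c)+c_1$. *)

(* Defs.v *)
From HB Require Import structures.
From mathcomp Require Import all_boot all_order all_algebra all_fingroup.
From mathcomp Require Import all_classical all_reals.

Set Implicit Arguments.
Unset Strict Implicit.
Unset Printing Implicit Defensive.

Import Order.TTheory GRing.Theory Num.Theory.

Local Open Scope classical_set_scope.
Local Open Scope ring_scope.

Definition dilate (R : realType) (n : nat) (t : nat) (X : set 'rV[R]_n) :
  set 'rV[R]_n := [set t%:R *: x | x in X].

Definition lattice (R : realType) (n : nat) : set 'rV[R]_n :=
  range (fun u : 'rV[int]_n => map_mx intr u).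

Arguments lattice : clear implicits.

(* The count m also asserts that the set of lattice points is finite. *)
Definition is_ehrhart_poly (R : realType) (n : nat) (X : set 'rV[R]_n)
    (E : {poly R}) : Prop :=
  forall t : nat, (0 < t)%N ->
    exists2 m : nat, (dilate t X `&` lattice R n #= `I_m)%card
                   & E.[t%:R] = m%:R.

(* At most one polynomial qualifies, so the predicate determines E(X, t),
   including its value at t = 0. *)
Lemma is_ehrhart_poly_uniq (R : realType) (n : nat) (X : set 'rV[R]_n)
    (E F : {poly R}) :
  is_ehrhart_poly X E -> is_ehrhart_poly X F -> E = F.
Proof.
move=> HE HF; apply/eqP; rewrite -subr_eq0; apply/eqP.
pose s := [seq t%:R : R | t <- iota 1 (size (E - F))].
have us : uniq s.
  by rewrite map_inj_uniq ?iota_uniq// => a b /eqP; rewrite eqr_nat => /eqP.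
apply: (@roots_geq_poly_eq0 _ _ s) => //; last by rewrite size_map size_iota.
apply/allP => _ /mapP[t + ->]; rewrite mem_iota => /andP[t0 _].
have [m Em Et] := HE t t0; have [p Fp Ft] := HF t t0.
rewrite /root hornerD hornerN Et Ft subr_eq0 eqr_nat; apply/eqP/card_eq_II.
by apply: card_eq_trans Fp; rewrite card_eq_sym.
Qed.

(* Formal power series are represented by their coefficient sequences. *)
Definition fps_mul (R : nzRingType) (f g : nat -> R) : nat -> R :=
  fun m => \sum_(i < m.+1) f i * g (m - i)%N.

Definition ehrhart_star (R : realType) (n : nat) (E : {poly R}) : nat -> R :=
  fps_mul (fun i => ((1 - 'X) ^+ n.+1 : {poly R})`_i) (fun t => E.[t%:R]).

Definition multi_hypersimplex (R : realType) (r n k : nat) : set 'rV[R]_n :=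
  [set v : 'rV[R]_n |
    [/\ forall i, 0 <= v 0 i <= r%:R,
        k%:R - 1 <= \sum_i v 0 i
      & if (k == r * n)%N then \sum_i v 0 i <= k%:R
        else \sum_i v 0 i < k%:R]].

Arguments multi_hypersimplex : clear implicits.

Local Close Scope classical_set_scope.

(* Positions and letters are numbered from 0: (w.1 i).+1 is the letter at
   position i.+1, and w.2 i is its color. *)
Definition colored_perm (r n : nat) := ('S_n * {ffun 'I_n -> 'I_r})%type.

Definition fexc (r n : nat) (w : colored_perm r n) : nat :=
  (r * #|[set i : 'I_n | (i < w.1 i)%N && (w.2 i == 0 :> nat)]|
   + \sum_(i < n) w.2 i)%N.

Definition des_star (r n : nat) (w : colored_perm r n) : nat :=
  #|[set i : 'I_n | [exists j : 'I_n, (j == i.+1 :> nat) &&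
       ((w.2 i < w.2 j)%N || ((w.2 i == w.2 j) && (w.1 j < w.1 i)%N))]]|.

(* The default value is only reached when n = 0. *)
Definition first_color (r n : nat) (w : colored_perm r n) : nat :=
  if insub 0%N is Some i then w.2 (i : 'I_n) else 0%N.

Definition fdes_star (r n : nat) (w : colored_perm r n) : nat :=
  (r * des_star w + first_color w)%N.

(* Main.v *)
Require Import Defs.
From HB Require Import structures.
From mathcomp Require Import all_boot all_order all_algebra all_fingroup.
From mathcomp Require Import all_classical all_reals.
From mathcomp Require Import zify ring.

Set Implicit Arguments.
Unset Strict Implicit.
Unset Printing Implicit Defensive.

Import Order.TTheory GRing.Theory Num.Theory.

(** After the symmetry [u = r t - v], the points of the [t]-th dilate are the
    [v] in [{0..rt}^n] with [floor ((sum v - 1) / t) = rn - k].  On the other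
    side, with [d = ceil (fdes* / r)], the binomial [C(t - d + n, n)] counts the
    weakly decreasing [b] in [{0..rt}^n] such that [b = c] modulo [r] and
    [sigma] increases on the blocks where [b] is constant, so that the right-hand
    side counts pairs [(sigma, b)].  Foata's fundamental transformation sends
    [sigma] to the word [pi] of its cycles, and [(sigma, b)] to the word
    [w = b o pi].  As in the Gessel-Reutenauer correspondence, this is a bijection
    onto all words in [{0..rt}^n]: the cycles of [sigma] cut [w] into its Lyndon
    factors, which gives injectivity, and both sides have the same cardinality by
    standardization.  Now [fexc] only depends on [w]: a position is an excedance
    exactly when the next different letter of [w] is smaller.  Finally this
    statistic on words and [floor ((sum v - 1) / t)] on the cube have generating
    functions satisfying the same recursion. *)

(* Whether the first letter different from the head of [w] is smaller. *)
Fixpoint falls (w : seq nat) : bool :=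
  if w is a :: w' then
    if w' is b :: _ then (b < a)%N || (a == b) && falls w' else false
  else false.

Fixpoint word_fexc (r : nat) (w : seq nat) : nat :=
  if w is a :: w' then
    ((if (r %| a)%N then r * falls w else a %% r) + word_fexc r w')%N
  else 0%N.

Lemma word_fexc_cons r a w : word_fexc r (a :: w) =
  ((if (r %| a)%N then r * falls (a :: w) else a %% r) + word_fexc r w)%N.
Proof. by []. Qed.

Lemma falls_cons2 a b w :
  falls (a :: b :: w) = (b < a)%N || (a == b) && falls (b :: w).
Proof. by []. Qed.

Lemma perm_ltn_total n (p : 'S_n) (i j : 'I_n) :
  [\/ p i < p j, p j < p i | i = j].
Proof.
case: (ltngtP (p i) (p j)) => [h|h|/val_inj/perm_inj ->].
- exact: Or31.
- exact: Or32.
- exact: Or33.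
Qed.

Lemma card_ltn_perm n (p : 'S_n) i : #|[set j | p j < p i]| = p i.
Proof.
have -> : [set j | p j < p i] = p @^-1: [set x : 'I_n | x < p i].
  by apply/setP => j; rewrite !inE.
rewrite card_preimset; last exact: perm_inj.
rewrite -sum1_card; under eq_bigl => x do rewrite inE.
by rewrite (big_ord_narrow (ltnW (ltn_ord (p i)))) sum1_card card_ord.
Qed.

(** The value at [i] is the number of smaller values. *)
Lemma perm_ltn_inj n (p q : 'S_n) :
  (forall i j, p i < p j -> q i < q j) -> p = q.
Proof.
move=> pq; apply/permP => i; apply/val_inj => /=.
rewrite -card_ltn_perm -[RHS]card_ltn_perm; apply: eq_card => j; rewrite !inE.
apply/idP/idP => [/pq //|qji].
case: (perm_ltn_total p i j) => [/pq|//|ij]; first by rewrite ltnNge ltnW.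
by rewrite ij ltnn in qji.
Qed.

(** * Foata's fundamental transformation on sorted words *)

Section Foata.

Variable n : nat.
Implicit Types (p : 'S_n) (i j k : 'I_n).

(* [p] is read as the concatenation of the cycles of [foata p]: each cycle starts
   with its minimum, and the minima decrease, so that the cycles start at the
   left-to-right minima of [p]; [run_min p j] is the first position of the cycle
   containing position [j]. *)
Definition run_min p j : 'I_n := [arg min_(i < j | i <= j) (p i : nat)].

Lemma run_min_le p j : run_min p j <= j.
Proof. by rewrite /run_min; case: arg_minnP. Qed.

Lemma run_min_min p i j : i <= j -> p (run_min p j) <= p i.
Proof. by rewrite /run_min; case: arg_minnP => // k _ h /h. Qed.

Lemma run_min_eq p i j :
  i <= j -> (forall k, k <= j -> p i <= p k) -> run_min p j = i.
Proof.
move=> ij h; apply: (@perm_inj _ p); apply/val_inj/eqP.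
by rewrite eqn_leq run_min_min //= h // run_min_le.
Qed.

Definition is_start p j := run_min p j == j.

Lemma start_ltn p i j : is_start p j -> i < j -> p j < p i.
Proof.
move=> /eqP sj ij; rewrite ltn_neqAle -{2}sj run_min_min 1?ltnW // andbT.
by apply: contraTneq ij => /val_inj/perm_inj ->; rewrite ltnn.
Qed.

Lemma run_min_start p j : is_start p (run_min p j).
Proof.
apply/eqP/run_min_eq => // k kj; apply: run_min_min.
exact: leq_trans kj (run_min_le p j).
Qed.

Lemma run_min_between p i j :
  run_min p j <= i -> i <= j -> run_min p i = run_min p j.
Proof.
by move=> ji ij; apply: run_min_eq => // k ki; apply/run_min_min/(leq_trans ki).
Qed.

Lemma run_min_succ p j k :
  k = j.+1 :> nat -> ~~ is_start p k -> run_min p k = run_min p j.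
Proof.
move=> kj nk; have := run_min_le p k; rewrite leq_eqVlt => /orP[/eqP/val_inj e|lt].
  by rewrite /is_start e eqxx in nk.
by apply/esym/run_min_between; rewrite ?kj // -ltnS -kj.
Qed.

Definition foata_next p j : 'I_n :=
  if insub j.+1 is Some k then if is_start p k then run_min p j else k
  else run_min p j.

Variant foata_next_spec p j : 'I_n -> Prop :=
| NextStep k of k = j.+1 :> nat & ~~ is_start p k : foata_next_spec p j k
| NextWrap of (forall k, k = j.+1 :> nat -> is_start p k) :
    foata_next_spec p j (run_min p j).

Lemma foata_nextP p j : foata_next_spec p j (foata_next p j).
Proof.
rewrite /foata_next; case: insubP => [k _ kj|nj].
  by case: ifP => sk; constructor; rewrite ?sk // => k' k'j;
    rewrite (_ : k' = k) //; apply: val_inj; rewrite /= k'j -kj.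
by constructor=> k kj; rewrite -kj ltn_ord in nj.
Qed.

Lemma foata_next_step p j k : k = j.+1 :> nat -> ~~ is_start p k -> foata_next p j = k.
Proof.
move=> kj nk; case: foata_nextP => [k' k'j _|h]; first by apply: val_inj; rewrite /= k'j.
by rewrite (h k kj) in nk.
Qed.

Lemma run_min_foata_next p j : run_min p (foata_next p j) = run_min p j.
Proof.
by case: foata_nextP => [k kj nk|_]; [exact: run_min_succ | exact/eqP/run_min_start].
Qed.

(** If [j < j'] and [j] ends its cycle, position [j + 1] carries a value below the minimum of that
    cycle, so [j'] lies in another one. *)
Lemma foata_next_inj p : injective (foata_next p).
Proof.
have wrap j j' : j < j' -> (forall k, k = j.+1 :> nat -> is_start p k) ->
    run_min p j <> run_min p j'.
  move=> jj' h e; pose k := Ordinal (leq_ltn_trans jj' (ltn_ord j')).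
  have /start_ltn/(_ (_ : run_min p j < k)) := h k erefl.
  rewrite ltnS run_min_le => /(_ isT).
  by rewrite ltnNge e run_min_min.
move=> j j'; case: foata_nextP => [k kj nk|h]; case: foata_nextP => [k' k'j nk'|h'].
- by move=> e; apply: val_inj; apply: succn_inj; rewrite -kj -k'j e.
- by move=> e; rewrite e run_min_start in nk.
- by move=> e; rewrite -e run_min_start in nk'.
case: (ltngtP j j') => [lt|lt|/val_inj //] e; first by case: (wrap _ _ lt h).
by case: (wrap _ _ lt h').
Qed.

Lemma run_min_iter p m j : run_min p (iter m (foata_next p) j) = run_min p j.
Proof. by elim: m => //= m IH; rewrite run_min_foata_next. Qed.

Lemma ord_pred_ex k : 0 < k -> exists j : 'I_n, k = j.+1 :> nat.
Proof.
move=> k0; have kn : k.-1 < n by apply: leq_ltn_trans (ltn_ord k); rewrite leq_pred.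
by exists (Ordinal kn); rewrite /= prednK.
Qed.

Lemma nonstart_pred p k : ~~ is_start p k -> exists j : 'I_n, k = j.+1 :> nat.
Proof.
move=> nk; apply: ord_pred_ex; rewrite lt0n; apply: contra nk => /eqP k0.
apply/eqP/val_inj; have := run_min_le p k; rewrite k0 leqn0 => /eqP.
by rewrite /= k0.
Qed.

Lemma iter_to_start p j : exists m, iter m (foata_next p) j = run_min p j.
Proof.
suff : fconnect (foata_next p) (run_min p j) j.
  rewrite fconnect_sym; last exact: foata_next_inj.
  by move=> /iter_findex e; exists (findex (foata_next p) j (run_min p j)).
move: {2}(val j).+1 (leqnn j.+1) => m; elim: m j => // m IH j.
rewrite ltnS => jm; case: (boolP (is_start p j)) => [/eqP -> //|nj].
have [i ji] := nonstart_pred nj.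
rewrite (@run_min_succ p i j) //; apply: (connect_trans (IH i _)).
  by rewrite -ji.
by rewrite -(@foata_next_step p i j) // fconnect1.
Qed.

Definition foata p : 'S_n := (p^-1 * perm (@foata_next_inj p) * p)%g.

Lemma foataE p j : foata p (p j) = p (foata_next p j).
Proof. by rewrite !permM permK permE. Qed.

Lemma foata_iter p m j : iter m (foata p) (p j) = p (iter m (foata_next p) j).
Proof. by elim: m => //= m ->; rewrite foataE. Qed.

(** [p] is recovered from [foata p] from left to right: a value inside a cycle is the image of the
    preceding one, and [start_le] forces the value at a start. *)
Lemma foata_inj : injective foata.
Proof.
(* The cycle through [q j] has minimum [q j], so this value also starts a cycle of [p], at a
   position not before [j]; and starts decrease. *)
have start_le p q j : foata p = foata q -> (forall i, i < j -> p i = q i) ->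
    is_start q j -> q j <= p j.
  move=> pq agree sj; have [m mE] := iter_to_start p (p^-1%g (q j)).
  set k := p^-1%g (q j) in mE; have pk : p k = q j by rewrite permKV.
  have le : q j <= p (run_min p k).
    rewrite -mE -foata_iter pk pq foata_iter.
    by rewrite -{1}(eqP sj) -(run_min_iter q m j) run_min_min.
  have sk : is_start p k.
    apply/eqP; apply: (@perm_inj _ p); apply/val_inj/eqP.
    by rewrite eqn_leq /= {2}pk le run_min_min.
  have : j <= k.
    rewrite leqNgt; apply/negP => kj; have := agree _ kj; rewrite pk.
    by move=> /perm_inj jk; rewrite jk ltnn in kj.
  rewrite -pk leq_eqVlt => /orP[/eqP/val_inj -> //|jk].
  exact/ltnW/start_ltn.
move=> p q pq; apply/permP => j.
move: {2}(val j).+1 (leqnn j.+1) => m; elim: m j => // m IH j.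
rewrite ltnS => jm; have agree i : i < j -> p i = q i.
  by move=> ij; apply: IH; apply: leq_trans jm.
(* If only [p'] starts a cycle at [j], the preceding value is sent to a value occurring before [j],
   which cannot be [q' j]. *)
have mixed p' q' : foata p' = foata q' -> (forall i, i < j -> p' i = q' i) ->
    is_start p' j -> ~~ is_start q' j -> False.
  move=> pq' ag sp nq; have [i ji] := nonstart_pred nq.
  have := foataE q' i; rewrite (@foata_next_step q' i j) // -pq' -ag ?ji // foataE.
  case: foata_nextP => [k ki nk|_].
    have kj : k = j by apply: val_inj; rewrite /= ki ji.
    by rewrite kj sp in nk.
  have lt : run_min p' i < j by rewrite ji ltnS run_min_le.
  by rewrite ag // => /perm_inj e; rewrite e ltnn in lt.
case: (boolP (is_start p j)) (boolP (is_start q j)) => sp [] sq.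
- apply/val_inj/eqP; rewrite eqn_leq /= (start_le q p) // => [|i /agree //].
  exact: start_le.
- by case: (mixed p q).
- by case: (mixed q p) => // i /agree.
have [i ji] := nonstart_pred sp.
by rewrite -[in LHS](@foata_next_step p i j) //
  -[in RHS](@foata_next_step q i j) // -!foataE pq agree // ji.
Qed.

(* The condition on [w = b o p] equivalent to [sorts (foata p) b] below. *)
Definition compat p (w : 'I_n -> nat) := forall i j, p i < p j ->
  w j <= w i /\ (w i = w j -> p (foata_next p i) < p (foata_next p j)).

(* Uniqueness of the Lyndon factorization.  If the factor starting at [s] ends
   earlier for [p] than for [q], take the last [y] in the [q]-factor with
   [p y < p s].  For [q] the suffix at [y] must differ from the factor before
   reaching its end, for [p] it cannot. *)
Lemma compat_start_absurd p q w k : compat p w -> compat q w ->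
  (forall i, i < k -> is_start p i = is_start q i) ->
  is_start p k -> ~~ is_start q k -> False.
Proof.
move=> cp cq agree pk nqk; set s := run_min q k.
have sk : s < k by rewrite ltn_neqAle run_min_le andbT.
have ps : is_start p s by rewrite agree // run_min_start.
pose Y y := (run_min q y == s) && (p y < p s).
have Yk : Y k by rewrite /Y eqxx start_ltn.
case: (@arg_maxnP _ k Y (fun y => y) Yk) => y /andP[/eqP qy py] ymax.
(* [a] and [c] advance together from [s] and [y]. As [p] and [q] order them oppositely, their
   letters agree and the conflict passes to their successors. *)
suff absurd m (a c : 'I_n) : n - c = m -> y <= c -> run_min q c = s -> a < c ->
    run_min p a = s -> p c < p a -> q a < q c -> False.
  have sy : s < y.
    rewrite ltn_neqAle -{2}qy run_min_le andbT.
    by apply: contraTneq py => /val_inj ->; rewrite ltnn.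
  apply: (absurd _ s y erefl) => //; first exact/eqP.
  rewrite ltn_neqAle -{2}qy run_min_min ?leqnn // andbT.
  by apply: contraTneq sy => /val_inj/perm_inj ->; rewrite ltnn.
elim: m a c => [|m IH] a c cm yc qc ac pa pca qac.
  by have := ltn_ord c; lia.
have [wac nxp] := cp _ _ pca; have [wca nxq] := cq _ _ qac.
have wE : w a = w c by apply/eqP; rewrite eqn_leq wac wca.
move: (nxp (esym wE)) (nxq wE) => {nxp nxq}.
have sa : s <= a by rewrite -pa run_min_le.
have qa : run_min q a = s by rewrite -qc; apply: run_min_between; rewrite ?qc // ltnW.
case: (foata_nextP q c) => [c' c'E nc'|_]; last first.
  by rewrite qc => _; rewrite ltnNge -{1}qa -(run_min_foata_next q a) run_min_min.
have qc' : run_min q c' = s by rewrite (@run_min_succ q c).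
have nlt : ~~ (p c' < p s).
  apply/negP => lt; have := ymax c'; rewrite /Y qc' eqxx lt => /(_ isT).
  by rewrite /= c'E leqNgt ltnS yc.
have nc'p : ~~ is_start p c'.
  by apply: contra nlt => /start_ltn; apply; rewrite c'E ltnS ltnW // (leq_ltn_trans sa).
rewrite (@foata_next_step p c c') //; case: (foata_nextP p a) => [a' a'E na'|_]; last first.
  by rewrite pa => lt; rewrite lt in nlt.
have a'c : a' <= c by rewrite a'E.
have qa' : run_min q a' = s.
  by rewrite -qc; apply: run_min_between; rewrite ?qc // a'E ltnW // ltnS.
rewrite (@foata_next_step q a a') //; last first.
  by rewrite /is_start qa'; apply: contraTneq sa => e; rewrite e a'E ltnn.
move=> h1 h2; apply: (IH a' c') => //.
- by rewrite c'E; lia.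
- by rewrite c'E ltnW.
- by rewrite c'E.
- by rewrite (@run_min_succ p a).
Qed.

Lemma compat_start p q w : compat p w -> compat q w -> is_start p =1 is_start q.
Proof.
move=> cp cq k; move: {2}(val k).+1 (leqnn k.+1) => m; elim: m k => // m IH k.
rewrite ltnS => km; have agree i : i < k -> is_start p i = is_start q i.
  by move=> ik; apply: IH; apply: leq_trans km.
case: (boolP (is_start p k)) (boolP (is_start q k)) => sp [] sq //.
  by case: (@compat_start_absurd p q w k).
by case: (@compat_start_absurd q p w k) => // i /agree.
Qed.

Lemma start_run_min p q : is_start p =1 is_start q -> run_min p =1 run_min q.
Proof.
move=> pq j; move: {2}(val j).+1 (leqnn j.+1) => m; elim: m j => // m IH j.
rewrite ltnS => jm; case: (boolP (is_start p j)) => sj.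
  by move: (sj); rewrite pq => /eqP ->; exact/eqP.
have [i ji] := nonstart_pred sj.
rewrite (@run_min_succ p i) // (@run_min_succ q i) -?pq //.
by apply: IH; rewrite -ji.
Qed.

Lemma start_foata_next p q : is_start p =1 is_start q -> foata_next p =1 foata_next q.
Proof.
move=> pq j; rewrite /foata_next; case: insubP => [k _ _|_]; last exact: start_run_min.
by rewrite pq (@start_run_min p q).
Qed.

(** Equal starts give equal successor maps. Two positions ordered oppositely by [p] and [q] have
    equal letters, so their successors are again ordered oppositely. *)
Lemma compat_inj p q w : compat p w -> compat q w -> p = q.
Proof.
move=> cp cq; have sE := compat_start cp cq.
have nE : foata_next q =1 foata_next p by move=> j; rewrite (@start_foata_next p q).
apply: perm_ltn_inj => i j pij.
case: (perm_ltn_total q i j) => [//|qji|ij]; last by rewrite ij ltnn in pij.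
have opposite m a b : p a < p b -> q b < q a ->
    p (iter m (foata_next p) a) < p (iter m (foata_next p) b) /\
    q (iter m (foata_next p) b) < q (iter m (foata_next p) a).
  elim: m a b => // m IH a b pab qba.
  have [wba nxp] := cp _ _ pab; have [wab nxq] := cq _ _ qba.
  have wE : w a = w b by apply/eqP; rewrite eqn_leq wab wba.
  rewrite !iterSr; apply: IH; first exact: nxp.
  by rewrite -!nE; apply: nxq.
(* Follow the pair until the first position reaches its start [s], then until the second reaches its
   start [t]. This yields [p s < p t] and [q t < q s], whereas starts decrease for both. *)
have [m mE] := iter_to_start p i; have [] := opposite m _ _ pij qji.
rewrite mE; set s := run_min p i; set y := iter m _ j => psy qys.
have [m' m'E] := iter_to_start p y; have [] := opposite m' _ _ psy qys.
have ss : is_start p s := run_min_start p i.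
have sy : is_start p (run_min p y) := run_min_start p y.
rewrite m'E; set t := run_min p y in sy *; set z := iter m' _ s => pzt qtz.
have psz : p s <= p z by rewrite -(eqP ss) -(run_min_iter p m' s) run_min_min.
have rE := start_run_min sE.
have qty : q t <= q y by rewrite /t rE run_min_min.
case: (ltngtP s t) => [st|ts|/val_inj st].
- by have := start_ltn sy st; rewrite ltnNge ltnW // (leq_ltn_trans psz).
- have sqs : is_start q s by rewrite -sE.
  by have := start_ltn sqs ts; rewrite ltnNge ltnW // (leq_ltn_trans qty).
by move: (leq_ltn_trans psz pzt); rewrite st ltnn.
Qed.

(** Descending induction on [j]. Inside a cycle, compatibility compares letters first and successors
    on ties, just as [falls] reads the suffix. The end of a cycle is no excedance, and the work is
    to exclude a fall across the cut. *)
Lemma compat_exc p w j : compat p w ->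
  (p j < p (foata_next p j)) = falls (drop j [seq w i | i <- enum 'I_n]).
Proof.
move=> cp; have dropE i : drop i [seq w i | i <- enum 'I_n] =
    w i :: drop i.+1 [seq w i | i <- enum 'I_n].
  have sz : i < size [seq w i | i <- enum 'I_n] by rewrite size_map size_enum_ord.
  by rewrite (drop_nth 0 sz) (nth_map i) ?size_enum_ord // nth_ord_enum.
move: {2}(n - j) (leqnn (n - j)) => m; elim: m j => [|m IH] j jm.
  by have := ltn_ord j; lia.
rewrite dropE; case: (ltnP j.+1 n) => [jn|nj]; last first.
  have -> : drop j.+1 [seq w i | i <- enum 'I_n] = [::].
    by apply: drop_oversize; rewrite size_map size_enum_ord.
  rewrite /=.
  case: foata_nextP => [k kj|_]; first by have := ltn_ord k; lia.
  by rewrite ltnNge run_min_min.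
pose k := Ordinal jn; have kj : k = j.+1 :> nat by [].
rewrite -kj dropE falls_cons2 -dropE -IH; last by rewrite kj; lia.
case: (boolP (is_start p k)) => sk; last first.
  rewrite (@foata_next_step p j k) //; case: (perm_ltn_total p j k) => [jk|jk|jk].
  - have [wkj nx] := cp _ _ jk; rewrite jk (@foata_next_step p j k) // in nx *.
    by case: ltngtP wkj => //= /esym/nx ->.
  - have [wjk nx] := cp _ _ jk; rewrite (@foata_next_step p j k) // in nx.
    rewrite ltnNge (ltnW jk) /=; case: ltngtP wjk => //= /nx h.
    by rewrite ltnNge (ltnW h).
  by have := kj; rewrite -jk; lia.
have nj : foata_next p j = run_min p j.
  by case: foata_nextP => // k' k'j; rewrite (_ : k' = k) ?sk //; apply: val_inj.
have pkj : p k < p j by apply: start_ltn => //; rewrite kj.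
rewrite nj ltnNge run_min_min //=.
have [wjk _] := cp _ _ pkj; case: ltngtP wjk => //= wE _; apply/esym/negP => pk.
set s := run_min p j in nj.
have pks : p k < p s by apply: start_ltn => //; rewrite kj ltnS run_min_le.
(* Otherwise [s] and [j] carry the same letter, and compatibility puts the successor of [s] below
   [p s], the minimum of its cycle. *)
have sj : s = j.
  case: (perm_ltn_total p s j) => [lt|lt|//].
    have [w1 nx] := cp _ _ lt; have [w2 _] := cp _ _ pks.
    have wsj : w s = w j by apply/eqP; rewrite eqn_leq w1 -wE w2.
    have e : run_min p (foata_next p s) = s.
      by rewrite run_min_foata_next (eqP (run_min_start p j)).
    by have := nx wsj; rewrite nj ltnNge -{1}e run_min_min.
  by have := run_min_min p (leqnn j); rewrite leqNgt lt.
(* Otherwise [p] would increase strictly along the cycle of [k], whose letters are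
   squeezed between those of [k] and [j]. *)
have climb m' : [/\ p k + m' <= p (iter m' (foata_next p) k), p (iter m' (foata_next p) k) < p j &
    p (iter m' (foata_next p) k) < p (iter m'.+1 (foata_next p) k)].
  elim: m' => [|m' [IH1 IH2 IH3]]; first by rewrite addn0.
  set y := iter m' _ k in IH1 IH2 IH3 *; set y' := foata_next p y.
  have weq z : p k <= p z -> p z < p j -> w z = w k.
    rewrite leq_eqVlt => /orP[/eqP/val_inj/perm_inj -> //|kz zj].
    have [a _] := cp _ _ kz; have [b _] := cp _ _ zj.
    by apply/eqP; rewrite eqn_leq a wE b.
  have ky : p k <= p y by apply: leq_trans IH1; rewrite leq_addr.
  have y'j : p y' < p j.
    by rewrite -sj -nj; apply: (cp _ _ IH2).2; rewrite weq.
  have ky' : p k <= p y' by rewrite ltnW // (leq_ltn_trans ky IH3).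
  split=> //=; first by rewrite addnS (leq_ltn_trans IH1).
  by apply: (cp _ _ IH3).2; rewrite !weq.
by have [h _ _] := climb n; have := ltn_ord (p (iter n (foata_next p) k)); lia.
Qed.

End Foata.

(** * Standardization *)

Lemma word_fexc_sum r s : word_fexc r s =
  \sum_(j < size s) (if r %| nth 0 s j then r * falls (drop j s) else nth 0 s j %% r).
Proof.
elim: s => [|a s IH]; first by rewrite big_ord0.
by rewrite word_fexc_cons big_ord_recl IH.
Qed.

Definition sorts n (s : 'S_n) (b : 'I_n -> nat) := [forall i : 'I_n, forall j : 'I_n,
  (i < j) ==> (b j <= b i) && ((b i == b j) ==> (s i < s j))].

Lemma sortsP n (s : 'S_n) (b : 'I_n -> nat) :
  reflect (forall i j : 'I_n, i < j -> b j <= b i /\ (b i = b j -> s i < s j)) (sorts s b).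
Proof.
apply: (iffP forallP) => [h i j ij|h i].
  by have /forallP/(_ j)/implyP/(_ ij)/andP[-> /implyP e] := h i; split=> // /eqP.
apply/forallP => j; apply/implyP => /h [-> e] /=.
by apply/implyP => /eqP.
Qed.

(** Rank positions by decreasing letter, then by index, and invert the ranking. *)
Lemma sorts_ex n (w : 'I_n -> nat) : exists s : 'S_n, sorts s (fun i => w (s i)).
Proof.
pose before (i j : 'I_n) := (w j < w i) || (w i == w j) && (i < j).
have btr : forall j i k, before i j -> before j k -> before i k.
  by move=> j i k; rewrite /before; lia.
have birr i : before i i = false by rewrite /before !ltnn andbF.
have btot i j : i != j -> before i j || before j i.
  by rewrite /before -val_eqE /=; lia.
pose rk i := #|[set j | before j i]|.
have rklt i : rk i < n.
  rewrite -[X in _ < X]card_ord -cardsT; apply/proper_card/properP; split.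
    exact: finset.subsetT.
  by exists i; rewrite ?inE // birr.
have rkmono i j : before i j -> rk i < rk j.
  move=> ij; apply/proper_card/properP; split.
    by apply/fintype.subsetP => k; rewrite !inE => /btr; apply.
  by exists i; rewrite !inE ?birr.
have rkinj : injective (fun i => Ordinal (rklt i)).
  move=> i j /(congr1 val) /= e; apply/eqP/contraT => /btot /orP[] /rkmono.
    by rewrite e ltnn.
  by rewrite e ltnn.
exists (perm rkinj)^-1%g; apply/sortsP => i j ij.
set i' := (perm rkinj)^-1%g i; set j' := (perm rkinj)^-1%g j.
have iE : i = rk i' :> nat by rewrite -[i in LHS](permKV (perm rkinj)) permE.
have jE : j = rk j' :> nat by rewrite -[j in LHS](permKV (perm rkinj)) permE.
have bij : before i' j'.
  have ne : i' != j' by apply: contraTneq ij => e; rewrite iE jE e ltnn.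
  by case/orP: (btot _ _ ne) => // /rkmono; rewrite -iE -jE ltnNge (ltnW ij).
by move: bij; rewrite /before; split; lia.
Qed.

(** * From sorted pairs to words *)

Section Transfer.

Variables (n N : nat).
Implicit Types (x : 'S_n * {ffun 'I_n -> 'I_N}).

Definition foata_pair x : 'S_n * {ffun 'I_n -> 'I_N} :=
  (foata x.1, [ffun i => x.2 (x.1^-1%g i)]).

Lemma foata_pair_inj : injective foata_pair.
Proof.
move=> [p w] [q v] [/foata_inj <- /ffunP e]; congr (_, _).
by apply/ffunP => i; have := e (p i); rewrite !ffunE permK.
Qed.

Lemma sorts_foata_pair x :
  sorts (foata_pair x).1 (fun i => (foata_pair x).2 i) -> compat x.1 (fun i => x.2 i).
Proof.
case: x => p w /sortsP h i j pij; have /= := h _ _ pij.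
by rewrite !ffunE !permK !foataE => -[].
Qed.

(** Undoing the sort maps [V] onto the words. Its preimage [C] under [foata_pair] has the same size
    and embeds into the words by [compat_inj]. Hence every word occurs exactly once in [C]. *)
Lemma card_sorts_transfer (Q : pred ('S_n * {ffun 'I_n -> 'I_N}))
    (P : pred {ffun 'I_n -> 'I_N}) :
  (forall p (w : {ffun 'I_n -> 'I_N}), compat p (fun i => w i) -> Q (foata_pair (p, w)) = P w) ->
  #|[set x : 'S_n * {ffun 'I_n -> 'I_N} | sorts x.1 (fun i => x.2 i) && Q x]| = #|[set w | P w]|.
Proof.
move=> QP; pose V := [set x : 'S_n * {ffun 'I_n -> 'I_N} | sorts x.1 (fun i => x.2 i)].
pose C := foata_pair @^-1: V.
have Ccompat x : x \in C -> compat x.1 (fun i => x.2 i).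
  by rewrite !inE; apply: sorts_foata_pair.
have sndI : {in C &, injective snd}.
  move=> [p w] [q v] /Ccompat cp /Ccompat cq /= wv; rewrite -wv in cq *.
  by congr (_, _); exact: compat_inj cp cq.
have cardV : #|{ffun 'I_n -> 'I_N}| <= #|V|.
  pose unsort x : {ffun 'I_n -> 'I_N} := [ffun i => x.2 (x.1^-1%g i)].
  apply: leq_trans (leq_imset_card unsort _); rewrite -cardsT.
  apply/subset_leq_card/fintype.subsetP => w _; apply/imsetP.
  have [s hs] := sorts_ex (fun i => w i).
  exists (s, [ffun i => w (s i)]).
    rewrite inE; apply: etrans hs => /=.
    by apply: eq_forallb => i; apply: eq_forallb => j; rewrite !ffunE.
  by apply/ffunP => i; rewrite !ffunE permKV.
have CV : #|C| = #|V| by rewrite card_preimset //; exact: foata_pair_inj.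
have sndC : snd @: C = [set: {ffun 'I_n -> 'I_N}].
  by apply/eqP; rewrite eqEcard finset.subsetT /= card_in_imset // CV cardsT.
rewrite -(card_preimset _ foata_pair_inj).
set X := _ @^-1: _.
have XC : {subset X <= C} by move=> x; rewrite !inE => /andP[].
rewrite -(card_in_imset (f := snd)); last by apply: sub_in2 sndI; exact: XC.
apply: eq_card => w; rewrite inE; apply/imsetP/idP => [[[p v] h ->]|Pw].
  have := h; rewrite !inE => /andP[_]; rewrite QP //=.
  by apply: (Ccompat (p, v)); exact: XC.
have /imsetP[[p v] h /= e] : w \in snd @: C by rewrite sndC inE.
exists (p, v) => //; move: (h); rewrite !inE => /= ->.
by rewrite QP -?e //=; rewrite e; exact: (Ccompat (p, v)).
Qed.

Definition pair_fexc r (s : 'S_n) (b : 'I_n -> nat) :=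
  r * #|[set i : 'I_n | (i < s i) && (r %| b i)]| + \sum_i (b i %% r).

Lemma card_sorts_fexc r m :
  #|[set x : 'S_n * {ffun 'I_n -> 'I_N} |
      sorts x.1 (fun i => x.2 i) && (pair_fexc r x.1 (fun i => x.2 i) == m)]|
  = #|[set w : {ffun 'I_n -> 'I_N} | word_fexc r [seq (w i : nat) | i <- enum 'I_n] == m]|.
Proof.
apply: (card_sorts_transfer (Q := fun x => pair_fexc r x.1 (fun i => x.2 i) == m)
 (P := fun w => word_fexc r [seq (w i : nat) | i <- enum 'I_n] == m)) => p w cp.
congr (_ == _); rewrite word_fexc_sum size_map size_enum_ord.
have -> : pair_fexc r (foata_pair (p, w)).1 (fun i => (foata_pair (p, w)).2 i) =
  \sum_i (if r %| (foata_pair (p, w)).2 i then r * (i < (foata_pair (p, w)).1 i)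
          else (foata_pair (p, w)).2 i %% r).
  rewrite /pair_fexc -sum1_card big_distrr /= big_mkcond -big_split /=.
  apply: eq_bigr => i _; rewrite !inE.
  case: ifP; case: ifP => //; case: (_ < _) => //= h1 h2; rewrite ?h1 ?h2 //.
    by rewrite (eqP h1) addn0.
  by rewrite (eqP h1) muln0.
rewrite (reindex_inj (@perm_inj _ p)) /=; apply: eq_bigr => i _.
rewrite !ffunE permK foataE (compat_exc _ cp).
by rewrite (nth_map i) ?size_enum_ord // nth_ord_enum.
Qed.

End Transfer.

Lemma sorts_adjacent n (s : 'S_n.+1) (b : 'I_n.+1 -> nat) :
  (forall k, k < n -> b (inord k.+1) <= b (inord k) /\
     (b (inord k) = b (inord k.+1) -> s (inord k) < s (inord k.+1))) ->
  sorts s b.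
Proof.
move=> h; apply/sortsP => i j ij.
rewrite -(inord_val i) -(inord_val j).
have : j <= n by rewrite -ltnS ltn_ord.
elim: (val j) ij => // k IH; rewrite ltnS leq_eqVlt => /orP[/eqP <- /h //|ik kn].
have [h1 h2] := IH ik (ltnW kn); have [g1 g2] := h k kn.
by split; lia.
Qed.

(* Colors are the last digits of [b] in base [r], hence the asymmetric
   definition of [des_star]. *)
Lemma leq_lex_digit r A A' c c' (s s' : nat) : c < r -> c' < r -> s != s' ->
  ((r * A' + c' <= r * A + c) && ((r * A + c == r * A' + c') ==> (s < s')))
  = (A' + ((c < c') || (c == c') && (s' < s)) <= A).
Proof.
move=> cr c'r ss; case: (ltngtP A A') => [lt|lt|->].
- have : r * A.+1 <= r * A' by rewrite leq_mul2l lt orbT.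
  by rewrite mulnS; lia.
- have : r * A'.+1 <= r * A by rewrite leq_mul2l lt orbT.
  by rewrite mulnS; lia.
by lia.
Qed.

(** * Sequences sorted by a given colored permutation *)

Section Fiber.

Variables (n r t : nat) (s : 'S_n.+1) (c : {ffun 'I_n.+1 -> 'I_r}).
Hypothesis r_gt0 : 0 < r.

Let cc k : nat := c (inord k).
Let drop_at k : nat := (cc k < cc k.+1) || (cc k == cc k.+1) && (s (inord k.+1) < s (inord k)).
(** The term [0 < cc 0] comes from the bound [r * t] on the first entry, see [top]. *)
Let drops k : nat := (0 < cc 0) + \sum_(l < k) drop_at l.

(** The ceiling of [fdes_star w / r], as the first color is below [r]; see [ceil_fdes_star]. *)
Definition star_ceil r n (w : colored_perm r n) := des_star w + (0 < first_color w).

Let dropsE : star_ceil (s, c) = drops n.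
Proof.
rewrite /star_ceil /des_star /first_color /drops addnC; congr (_ + _).
  case: insubP => [i _ /= i0|//]; congr (nat_of_bool (_ < nat_of_ord (c _))).
  by apply: val_inj; rewrite /= i0 inordK.
rewrite -sum1_card big_mkcond big_ord_recr /= inE.
rewrite [X in _ + X](_ : _ = 0) ?addn0; last first.
  by case: existsP => // -[j /andP[/eqP jn _]]; have := ltn_ord j; rewrite jn ltnn.
apply: eq_bigr => k _; rewrite inE /drop_at /cc.
have -> : widen_ord (leqnSn n) k = inord k.
  by apply: val_inj; rewrite /= inordK // ltnS ltnW.
have kk : (inord k : 'I_n.+1) = k :> nat by rewrite inordK // ltnS ltnW.
congr (nat_of_bool _); apply/existsP/idP => [[j /andP[/eqP jk]]|h].
  rewrite (_ : j = inord k.+1) //=.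
  by apply: val_inj; rewrite /= jk kk inordK // ltnS.
by exists (inord k.+1); rewrite kk inordK ?eqxx //= ltnS.
Qed.

Let drops_le k : k <= n -> drops k <= drops n.
Proof.
move=> /subnK <-; elim: (n - k) => // m; rewrite addSn.
by rewrite [drops (m + k).+1]/drops big_ord_recr /= addnA => /leq_trans; apply; exact: leq_addr.
Qed.

Let dropsS k : drops k.+1 = drops k + drop_at k.
Proof. by rewrite /drops big_ord_recr /= addnA. Qed.

Let cc_lt k : cc k < r. Proof. exact: ltn_ord. Qed.

Let s_neq k : k < n -> s (inord k) != s (inord k.+1) :> nat.
Proof.
move=> kn; apply/eqP => /val_inj/perm_inj/(congr1 val) /=.
by rewrite !inordK ?ltnS //; lia.
Qed.

Let step A A' k : k < n ->
  ((r * A' + cc k.+1 <= r * A + cc k) &&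
   ((r * A + cc k == r * A' + cc k.+1) ==> (s (inord k) < s (inord k.+1))))
  = (A' + drop_at k <= A).
Proof. by move=> kn; apply: leq_lex_digit; rewrite ?s_neq. Qed.

Let top A : (r * A + cc 0 <= r * t) = (A + (0 < cc 0) <= t).
Proof.
case: (posnP (cc 0)) => [->|c0]; first by rewrite !addn0 leq_pmul2l.
rewrite addn1; case: (ltnP A t) => h.
  have : r * A.+1 <= r * t by rewrite leq_mul2l h orbT.
  by have := cc_lt 0; rewrite mulnS; lia.
by have : r * t <= r * A; [rewrite leq_mul2l h orbT | lia].
Qed.

Definition fiber := [set b : {ffun 'I_n.+1 -> 'I_(r * t).+1} |
  sorts s (fun i => b i) && [forall i, b i %% r == c i]].

Let fiber_chain b : b \in fiber -> exists A : nat -> nat,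
  [/\ forall k, k <= n -> b (inord k) = r * A k + cc k :> nat,
      A 0 + (0 < cc 0) <= t & forall k, k < n -> A k.+1 + drop_at k <= A k].
Proof.
rewrite inE => /andP[/sortsP sb /forallP cb].
exists (fun k => b (inord k) %/ r).
have bE k : k <= n -> b (inord k) = r * (b (inord k) %/ r) + cc k :> nat.
  by move=> kn; rewrite {1}(divn_eq (b (inord k)) r) mulnC (eqP (cb _)).
split=> //; first by rewrite -top -bE // -ltnS ltn_ord.
move=> k kn; rewrite -step // -!bE //; last exact: ltnW.
have /sb[-> e] /= : (inord k : 'I_n.+1) < (inord k.+1 : 'I_n.+1).
  by rewrite !inordK ?ltnS // ltnW.
by apply/implyP => /eqP.
Qed.

Let chain_fiber (b : {ffun 'I_n.+1 -> 'I_(r * t).+1}) (A : nat -> nat) :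
  (forall k, k <= n -> b (inord k) = r * A k + cc k :> nat) ->
  (forall k, k < n -> A k.+1 + drop_at k <= A k) -> b \in fiber.
Proof.
move=> bE chain; rewrite inE; apply/andP; split; last first.
  apply/forallP => i; rewrite -[i]inord_val bE; last by rewrite -ltnS ltn_ord.
  by rewrite mulnC modnMDl modn_small.
apply: sorts_adjacent => k kn; rewrite !bE //; last exact: ltnW.
have := chain k kn; rewrite -step // => /andP[-> /implyP e]; split=> // /eqP.
exact: e.
Qed.

Let chain_bounds (A : nat -> nat) : A 0 + (0 < cc 0) <= t ->
  (forall k, k < n -> A k.+1 + drop_at k <= A k) ->
  forall k, k <= n -> drops n <= A k + drops k <= t.
Proof.
move=> A0 chain k kn; apply/andP; split.
  rewrite -(subKn kn); have : n - k <= n by rewrite leq_subr.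
  elim: (n - k) => [|m IH] mn; first by rewrite subn0 leq_addl.
  apply: leq_trans (IH (ltnW mn)) _.
  have lt : n - m.+1 < n by lia.
  have := chain _ lt; have <- : (n - m.+1).+1 = n - m by lia.
  by rewrite dropsS; lia.
elim: k kn => [|k IH] kn; first by rewrite /drops big_ord0 addn0.
by have := IH (ltnW kn); have := chain k kn; rewrite dropsS; lia.
Qed.

(** Write the entries of [b] as [r * A k + cc k]. The conditions say that [A k + drops k] decreases
    weakly between [t] and [d = drops n], so [n + 1] values are chosen with repetition among
    [t - d + 1]. *)
Lemma card_fiber : #|fiber| = 'C(t + n.+1 - star_ceil (s, c), n.+1).
Proof.
rewrite dropsE; set d := drops n; case: (leqP d t) => [dt|td]; last first.
  rewrite bin_small; last by lia.
  apply: eq_card0 => b; apply/negP => /fiber_chain[A [_ A0 ch]].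
  by have /andP[h1 h2] := chain_bounds A0 ch (leqnn n); rewrite -/d in h1; lia.
pose T := [set a : (n.+1).-tuple 'I_(t - d).+1 | sorted leq [seq val i | i <- a]].
pose al (a : (n.+1).-tuple 'I_(t - d).+1) k : nat := tnth a (inord k).
(* The tuple records the slacks [t - (A k + drops k)], which increase weakly within [0..t - d]. *)
pose A a k := t - drops k - al a k.
pose h a : {ffun 'I_n.+1 -> 'I_(r * t).+1} := [ffun i : 'I_n.+1 => inord (r * A a i + cc i)].
have al_le a k : al a k <= t - d by rewrite -ltnS ltn_ord.
have nth_al (a : (n.+1).-tuple 'I_(t - d).+1) k : k <= n -> nth 0 [seq val i | i <- a] k = al a k.
  move=> kn; rewrite (nth_map ord0) ?size_tuple // /al (tnth_nth ord0) inordK //.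
have sortedE (a : (n.+1).-tuple 'I_(t - d).+1) :
    reflect (forall k, k < n -> al a k <= al a k.+1) (a \in T).
  rewrite inE; apply: (iffP (sortedP 0)) => H k kn.
    by rewrite -!nth_al ?(ltnW kn) //; apply: H; rewrite size_map size_tuple ltnS.
  rewrite size_map size_tuple ltnS in kn.
  by rewrite !nth_al ?(ltnW kn) //; exact: H.
have chainT a : a \in T -> forall k, k < n -> A a k.+1 + drop_at k <= A a k.
  move=> /sortedE aT k kn; have := aT k kn; have := al_le a k.+1.
  by have := drops_le kn; rewrite /A -/d dropsS; lia.
have topT a : A a 0 + (0 < cc 0) <= t.
  have := drops_le (leq0n n); have := al_le a 0.
  by rewrite /A -/d (_ : drops 0 = (0 < cc 0)) ?/drops ?big_ord0 ?addn0 //; lia.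
have hE a : a \in T -> forall k, k <= n -> h a (inord k) = r * A a k + cc k :> nat.
  move=> aT k kn; have ik : (inord k : 'I_n.+1) = k :> nat by rewrite inordK.
  rewrite ffunE ik inordK // ltnS {ik}.
  elim: k kn => [|k IH] kn; first by rewrite top.
  apply: leq_trans (IH (ltnW kn)).
  by have := chainT a aT k kn; rewrite -step // => /andP[].
have hinj : {in T &, injective h}.
  move=> a a' aT a'T e; apply: eq_from_tnth => i; apply: val_inj.
  have ii : i <= n by rewrite -ltnS ltn_ord.
  have := hE a aT i ii; rewrite e hE // => /addIn/eqP.
  rewrite eqn_pmul2l // /A /al inord_val.
  have := drops_le ii; rewrite -/d; have := ltn_ord (tnth a i).
  by have := ltn_ord (tnth a' i) => /=; lia.
have -> : fiber = h @: T.
  apply/setP => b; apply/idP/imsetP => [/fiber_chain[B [bE B0 ch]]|[a aT ->]].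
    have bd := chain_bounds B0 ch.
    pose a := [tuple (inord (t - (B i + drops i)) : 'I_(t - d).+1) | i < n.+1].
    have aE k : k <= n -> al a k = t - (B k + drops k).
      move=> kn; rewrite /al tnth_mktuple inordK inordK //.
      by have := bd k kn; rewrite -/d; lia.
    have aT : a \in T.
      apply/sortedE => k kn; rewrite !aE //; last exact: ltnW.
      by have := ch k kn; rewrite dropsS; lia.
    exists a => //; apply/ffunP => i; rewrite -[i]inord_val; apply: val_inj => /=.
    have ii : i <= n by rewrite -ltnS ltn_ord.
    rewrite bE // hE //; congr (r * _ + _); rewrite /A aE //.
    by have := bd i ii; lia.
  by apply: (@chain_fiber _ (A a)); [exact: hE | exact: chainT].
rewrite card_in_imset // card_sorted_tuples; congr 'C(_, _); lia.
Qed.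

End Fiber.

(** * Words and points of the cube *)

Local Open Scope ring_scope.

Fixpoint word_sum (V : nmodType) (N n : nat) (F : seq nat -> V) {struct n} : V :=
  if n is n'.+1 then \sum_(c < N) word_sum N n' (fun w => F (nat_of_ord c :: w))
  else F [::].

Lemma eq_word_sum (V : nmodType) N n (F G : seq nat -> V) :
  F =1 G -> word_sum N n F = word_sum N n G.
Proof.
elim: n F G => [|n IH] F G FG //=.
by apply: eq_bigr => c _; apply: IH => w; apply: FG.
Qed.

Lemma word_sumD (V : nmodType) N n (F G : seq nat -> V) :
  word_sum N n (fun w => F w + G w) = word_sum N n F + word_sum N n G.
Proof.
elim: n F G => [|n IH] F G //=.
by rewrite -big_split; apply: eq_bigr => c _; rewrite /= -IH.
Qed.

Lemma word_sumMl (K : nzRingType) N n (a : K) (F : seq nat -> K) :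
  word_sum N n (fun w => a * F w) = a * word_sum N n F.
Proof.
elim: n F => [|n IH] F //=.
by rewrite big_distrr; apply: eq_bigr => c _; rewrite /= -IH.
Qed.

Lemma word_sum0 (V : nmodType) N n : word_sum N n (fun _ => 0) = 0 :> V.
Proof. by elim: n => [|n IH] //=; rewrite big1. Qed.

Lemma word_sum_zero_word (V : nmodType) N n (a : V) :
  word_sum N.+1 n (fun w => if sumn w == 0%N then a else 0) = a.
Proof.
elim: n => [|n IH] //=; rewrite big_ord_recl /= big1 ?addr0 => [|c _].
  by rewrite -{2}IH; apply: eq_word_sum => w; rewrite add0n.
by rewrite -{1}[RHS](word_sum0 V N.+1 n); apply: eq_word_sum => w.
Qed.

Lemma sum_nat_split (V : nmodType) (f : nat -> V) n m p : (m <= n)%N -> (n <= p)%N ->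
  \sum_(m <= i < p) f i = \sum_(m <= i < n) f i + \sum_(n <= i < p) f i.
Proof. exact: big_cat_nat. Qed.

Lemma sum_nat_block (V : nmodType) (f : nat -> V) m d :
  \sum_(0 <= v < m * d) f v = \sum_(0 <= i < m) \sum_(0 <= q < d) f (i * d + q)%N.
Proof.
elim: m => [|m IH]; first by rewrite mul0n !big_nil.
rewrite big_nat_recr //= -IH mulSnr [LHS](@sum_nat_split _ _ (m * d)%N) ?leq_addr //.
congr (_ + _); rewrite -{1}[(m * d)%N]add0n big_addn addnC addnK.
by apply: eq_bigr => q _; rewrite addnC.
Qed.

Section WordsAndCube.

Variables (K : comNzRingType) (x : K) (r t : nat).
Hypotheses (r_gt0 : (0 < r)%N) (t_gt0 : (0 < t)%N).
Lemma prednK_r : r = r.-1.+1. Proof. by rewrite prednK. Qed.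
Local Notation N := (r * t).+1.
Definition geom : K := \sum_(0 <= i < r) x ^+ i.
Definition geom_tail : K := \sum_(0 <= i < r.-1) x ^+ i.+1.

Lemma sum_below_recl (f : nat -> K) :
  \sum_(0 <= i < r) f i = f 0%N + \sum_(0 <= i < r.-1) f i.+1.
Proof. by rewrite {1}prednK_r big_nat_recl. Qed.
Lemma sum_below_recr (f : nat -> K) :
  \sum_(0 <= i < r) f i = \sum_(0 <= i < r.-1) f i + f r.-1.
Proof. by rewrite {1}prednK_r big_nat_recr. Qed.

Lemma geom_recl : geom = 1 + geom_tail.
Proof. exact: sum_below_recl. Qed.
Lemma geomMx : geom * x = geom_tail + x ^+ r.
Proof.
rewrite mulrC big_distrr /= sum_below_recr /= -exprS -prednK_r; congr (_ + _).
by apply: eq_bigr => i _; rewrite exprS.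
Qed.

(** [q] is the sum of the letters already read. As [0.-1 = 0], the zero word with [q = 0] has
    exponent 0 instead of -1, whence the correction [1 - x] in [cube_gf_top]. *)
Definition cube_gf n q := word_sum N n (fun v => x ^+ ((q + sumn v).-1 %/ t)).

Lemma cube_gf_step n q : cube_gf n.+1 q = \sum_(0 <= v < N) cube_gf n (q + v)%N.
Proof.
rewrite big_mkord; apply: eq_bigr => v _.
by apply: eq_word_sum => w /=; rewrite addnA.
Qed.

Lemma cube_gf_shift n q i : (0 < q)%N -> cube_gf n (i * t + q)%N = x ^+ i * cube_gf n q.
Proof.
move=> q0; rewrite -word_sumMl; apply: eq_word_sum => w.
rewrite -exprD; congr (_ ^+ _).
have -> : ((i * t + q + sumn w).-1 = i * t + (q + sumn w).-1)%N by lia.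
by rewrite divnMDl.
Qed.

(** Passing from [q] to [q + 1] shifts the range of the first partial sum: [q] leaves it and
    [q + 1 + r * t] enters, with a factor [x ^+ r]. *)
Lemma cube_gf_rec n q :
  cube_gf n.+1 q = cube_gf n q + cube_gf n.+1 q.+1 - x ^+ r * cube_gf n q.+1.
Proof.
rewrite !cube_gf_step (big_nat_recl _ _ _ _) //= addn0 [X in _ + X - _]big_nat_recr //=.
have -> : cube_gf n (q.+1 + r * t)%N = x ^+ r * cube_gf n q.+1 by rewrite addnC cube_gf_shift.
rewrite addrA addrK; congr (_ + _); apply: eq_bigr => i _.
by rewrite addnS.
Qed.

Lemma cube_gf_top n : cube_gf n t = x * cube_gf n 0%N + (1 - x).
Proof.
rewrite -(word_sum_zero_word (r * t) n (1 - x)) -word_sumMl -word_sumD.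
apply: eq_word_sum => w; rewrite add0n.
case: (sumn w) => [|s] /=.
  by rewrite addn0 div0n divn_small ?prednK // expr0; ring.
have -> : ((t + s.+1).-1 = 1 * t + s)%N by lia.
by rewrite divnMDl // add1n exprS addr0.
Qed.

(** A positive letter is [i * t + c + 1] with [i < r] and [c < t]; the quotients [i] contribute
    [geom]. *)
Lemma cube_gf_zero n : cube_gf n.+1 0%N = cube_gf n 0%N + \sum_(0 <= c < t) geom * cube_gf n c.+1.
Proof.
rewrite cube_gf_step (big_nat_recl _ _ _ _) //=; congr (_ + _).
rewrite sum_nat_block exchange_big /=; apply: eq_bigr => c _.
rewrite big_distrl /=; apply: eq_bigr => i _.
by rewrite add0n -addnS cube_gf_shift.
Qed.

Definition words_gf n := word_sum N n (fun w => x ^+ word_fexc r w).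
Definition words_from n a := word_sum N n (fun w => x ^+ word_fexc r (a :: w)).
(** When [r] divides [a], the head weighs 1 in [words_up] and [x ^+ r] in [words_down], so each
    satisfies a recursion of its own. *)
Definition words_up n a := word_sum N n (fun w =>
  if falls (a :: w) then 0 else x ^+ word_fexc r (a :: w)).
Definition words_down n a := word_sum N n (fun w =>
  if falls (a :: w) then x ^+ word_fexc r (a :: w) else 0).

Lemma words_gf_step n : words_gf n.+1 = \sum_(0 <= a < N) words_from n a.
Proof. by rewrite big_mkord. Qed.

Lemma words_from_split n a : words_from n a = words_up n a + words_down n a.
Proof.
rewrite -word_sumD; apply: eq_word_sum => w.
by case: falls; rewrite ?add0r ?addr0.
Qed.

Lemma words_from0 n : words_from n 0%N = words_gf n.
Proof.
apply: eq_word_sum => w; rewrite word_fexc_cons dvdn0; congr (_ ^+ _).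
suff -> : falls (0%N :: w) = false by rewrite muln0.
by elim: w => [|[|b] w IH].
Qed.

Lemma words_from_nonmult n c q : (0 < q < r)%N -> words_from n (c * r + q)%N = x ^+ q * words_gf n.
Proof.
move=> /andP[q0 qr_]; rewrite -word_sumMl; apply: eq_word_sum => w.
rewrite -exprD word_fexc_cons; congr (_ ^+ (_ + _)).
rewrite dvdn_addr ?dvdn_mull // gtnNdvd //.
by rewrite modnMDl modn_small.
Qed.

Lemma words_up_step n a : (r %| a)%N -> (a < N)%N ->
  words_up n.+1 a = \sum_(a.+1 <= c < N) words_from n c + words_up n a.
Proof.
move=> ra aN.
have -> : words_up n.+1 a = \sum_(0 <= c < N) word_sum N n (fun w =>
   if falls (a :: c :: w) then 0 else x ^+ word_fexc r (a :: c :: w)).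
  by rewrite big_mkord.
rewrite (@sum_nat_split _ _ a) // 1?ltnW // big_nat big1 ?add0r => [|c /andP[_ ca]].
  rewrite (big_ltn aN) addrC; congr (_ + _).
    rewrite big_nat [RHS]big_nat; apply: eq_bigr => c /andP[ac _].
    apply: eq_word_sum => w.
    by rewrite !word_fexc_cons falls_cons2 ltnNge (ltnW ac) (ltn_eqF ac) ra muln0.
  apply: eq_word_sum => w; rewrite word_fexc_cons falls_cons2 ltnn eqxx ra /=.
  by case: ifP => // ->; rewrite muln0.
by rewrite -{1}[RHS](word_sum0 K N n); apply: eq_word_sum => w; rewrite falls_cons2 ca.
Qed.

Lemma words_down_step n a : (r %| a)%N -> (a < N)%N ->
  words_down n.+1 a = x ^+ r * (\sum_(0 <= c < a) words_from n c + words_down n a).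
Proof.
move=> ra aN.
have -> : words_down n.+1 a = \sum_(0 <= c < N) word_sum N n (fun w =>
   if falls (a :: c :: w) then x ^+ word_fexc r (a :: c :: w) else 0).
  by rewrite big_mkord.
rewrite (@sum_nat_split _ _ a.+1) // addrC big_nat big1 ?add0r => [|c /andP[ac _]].
  rewrite big_nat_recr // mulrDr; congr (_ + _).
    rewrite mulr_sumr big_nat [RHS]big_nat; apply: eq_bigr => c /andP[_ ca].
    rewrite -word_sumMl; apply: eq_word_sum => w.
    by rewrite word_fexc_cons falls_cons2 ca ra muln1 exprD.
  rewrite -word_sumMl; apply: eq_word_sum => w; rewrite word_fexc_cons falls_cons2 ltnn eqxx ra /=.
  by case: ifP => // fl; rewrite ?fl ?muln1 ?exprD ?mulr0.
rewrite -{1}[RHS](word_sum0 K N n); apply: eq_word_sum => w.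
by rewrite falls_cons2 ltnNge (ltnW ac) (ltn_eqF ac).
Qed.

(* For [c > 0], the words of length [n.+1] whose first letter is in
   [(c - 1) r + 1 .. c r].  The formula for [c = 0] counts letters that do not
   exist, but keeps the recursion [window_rec] uniform. *)
Definition window n c := words_from n (c * r)%N + geom_tail * words_gf n.

(** Letters prime to the grid of multiples of [r] weigh the same in every block, so a multiple may
    close its block, as here, or open it, as in [window_below], with the same sum. *)
Lemma window_above n c : \sum_((c * r).+1 <= l < (c.+1 * r).+1) words_from n l = window n c.+1.
Proof.
rewrite -{1}[(c * r).+1]add0n big_addn.
have -> : ((c.+1 * r).+1 - (c * r).+1 = r)%N by lia.
rewrite sum_below_recr addrC; congr (_ + _).
  by congr (words_from n _); move: r_gt0; lia.
rewrite big_distrl /= big_nat [RHS]big_nat; apply: eq_bigr => i /andP[_ ir].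
by rewrite addnC addSnnS words_from_nonmult //=; move: r_gt0; lia.
Qed.

Lemma window_below n c : \sum_(c * r <= l < c.+1 * r) words_from n l = window n c.
Proof.
rewrite -{1}[(c * r)%N]add0n big_addn.
have -> : (c.+1 * r - c * r = r)%N by lia.
rewrite sum_below_recl; congr (_ + _).
rewrite big_distrl /= big_nat [RHS]big_nat; apply: eq_bigr => i /andP[_ ir].
by rewrite addnC words_from_nonmult //=; move: r_gt0; lia.
Qed.

Lemma dvdn_mult_letter c : (r %| c * r)%N. Proof. exact: dvdn_mull. Qed.
Lemma mult_letter_bound c : (c <= t)%N -> (c * r < N)%N.
Proof. by rewrite ltnS mulnC leq_pmul2l. Qed.

Lemma words_up_diff n c : (c < t)%N ->
  words_up n.+1 (c * r) - words_up n.+1 (c.+1 * r) =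
  window n c.+1 + words_up n (c * r) - words_up n (c.+1 * r).
Proof.
move=> ct; rewrite !words_up_step ?mult_letter_bound ?dvdn_mult_letter // 1?ltnW //.
rewrite (@sum_nat_split _ _ (c.+1 * r).+1) //=; last exact: mult_letter_bound.
  by rewrite window_above; ring.
by rewrite ltnS leq_pmul2r.
Qed.

Lemma words_down_diff n c : (c < t)%N ->
  words_down n.+1 (c * r) - words_down n.+1 (c.+1 * r) =
  x ^+ r * (words_down n (c * r) - words_down n (c.+1 * r) - window n c).
Proof.
move=> ct; rewrite !words_down_step ?mult_letter_bound ?dvdn_mult_letter // 1?ltnW //.
rewrite [X in _ - _ * (X + _)](@sum_nat_split _ _ (c * r)) //=; last by rewrite leq_pmul2r.
by rewrite window_below; ring.
Qed.

(** In the combined difference formulas, the two windows differ by a difference of [words_from],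
    whose up and down parts cancel the rest. *)
Lemma words_balance n c : (c < t)%N ->
  x ^+ r * (words_up n (c * r) - words_up n (c.+1 * r))
  + (words_down n (c * r) - words_down n (c.+1 * r)) = 0.
Proof.
move=> ct; case: n => [|n].
  rewrite /words_up /words_down /= !dvdn_mult_letter !muln0; ring.
by rewrite words_up_diff // words_down_diff // /window !words_from_split; ring.
Qed.

(** The counterpart of [cube_gf_rec]: adding the two difference formulas leaves an error that
    vanishes by [words_balance]. *)
Lemma window_rec n c : (c < t)%N ->
  window n.+1 c = window n c + window n.+1 c.+1 - x ^+ r * window n c.+1.
Proof.
move=> ct; have := words_balance n ct; have := words_up_diff n ct.
have := words_down_diff n ct; rewrite /window !words_from_split => E1 E0 B.
apply/eqP; rewrite -subr_eq0; apply/eqP.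
transitivity (words_up n.+1 (c * r) - words_up n.+1 (c.+1 * r)
  + (words_down n.+1 (c * r) - words_down n.+1 (c.+1 * r))
  - (words_up n (c * r) + words_down n (c * r) + geom_tail * words_gf n)
  + x ^+ r * (words_up n (c.+1 * r) + words_down n (c.+1 * r) + geom_tail * words_gf n));
  first by ring.
by move/(congr1 -%R): B; rewrite oppr0 E0 E1 => B; rewrite -[RHS]B; ring.
Qed.

(** From the largest letter, only the constant word does not fall. *)
Lemma words_up_top n : words_up n (t * r)%N = 1.
Proof.
elim: n => [|n IH]; first by rewrite /words_up /= dvdn_mult_letter muln0.
by rewrite words_up_step ?mult_letter_bound ?dvdn_mult_letter // mulnC big_geq // add0r mulnC.
Qed.

Lemma window_top n : window n.+1 t = geom * (x * words_gf n.+1 + (1 - x)).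
Proof.
have words_gfE : words_gf n.+1 = \sum_(0 <= l < t * r) words_from n l + words_from n (t * r)%N.
  by rewrite words_gf_step mulnC big_nat_recr.
have -> : window n.+1 t = (geom_tail + x ^+ r) * words_gf n.+1 + 1 - x ^+ r.
  rewrite /window words_from_split words_up_top words_down_step
    ?mult_letter_bound ?dvdn_mult_letter //.
  have -> : words_down n (t * r)%N = words_from n (t * r)%N - 1.
    by rewrite words_from_split words_up_top; ring.
  by rewrite addrA -words_gfE; ring.
rewrite mulrDr mulrA geomMx mulrBr mulr1 geomMx geom_recl; ring.
Qed.

Lemma words_gf_window n : words_gf n.+1 = words_gf n + \sum_(0 <= c < t) window n c.+1.
Proof.
rewrite words_gf_step big_nat_recl // words_from0; congr (_ + _).
rewrite mulnC sum_nat_block; apply: eq_bigr => c _.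
rewrite -window_above -{1}[(c * r).+1]add0n big_addn.
have -> : ((c.+1 * r).+1 - (c * r).+1 = r)%N by lia.
by apply: eq_bigr => i _; rewrite addnS addnC.
Qed.

(** [words_gf_window] and [cube_gf_zero] increase the length; [window_top] and [cube_gf_top] then
    settle [c = t], from which [window_rec] and [cube_gf_rec] descend in [c]. *)
Lemma words_cube n :
  words_gf n = cube_gf n 0%N /\ forall c, (0 < c <= t)%N -> window n c = geom * cube_gf n c.
Proof.
elim: n => [|n [IHwords IHwindow]].
  split=> [|c /andP[c0 ct]]; first by rewrite /words_gf /cube_gf /= div0n.
  rewrite /window /words_gf /words_from /cube_gf /= dvdn_mult_letter muln0 expr0.
  rewrite divn_small ?expr0; last by lia.
  by rewrite geom_recl; ring.
have words_cube_gf : words_gf n.+1 = cube_gf n.+1 0%N.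
  rewrite words_gf_window cube_gf_zero IHwords; congr (_ + _).
  by rewrite big_nat [RHS]big_nat; apply: eq_bigr => c /andP[_ ct]; rewrite IHwindow.
split=> // c /andP[c0 ct].
rewrite -(subKn ct); have : (t - c < t)%N by lia.
elim: (t - c)%N => [|d IHd] dt; first by rewrite subn0 window_top cube_gf_top words_cube_gf.
rewrite window_rec; last by lia.
rewrite cube_gf_rec.
have -> : (t - d.+1).+1 = (t - d)%N by lia.
by rewrite IHd ?(ltnW dt) // !IHwindow; [ring | lia | lia].
Qed.

Lemma word_sum_fexc n :
  word_sum N n (fun w => x ^+ word_fexc r w) =
  word_sum N n (fun v => x ^+ ((sumn v).-1 %/ t)).
Proof. exact: (words_cube n).1. Qed.

End WordsAndCube.

(** * From generating functions to cardinalities *)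

Lemma word_sum_ffun (V : nmodType) N n (F : seq nat -> V) :
  word_sum N n F =
  \sum_(f : {ffun 'I_n -> 'I_N}) F [seq (f i : nat) | i <- enum 'I_n].
Proof.
elim: n F => [|n IH] F /=.
  rewrite (eq_bigr (fun=> F [::])) => [|f _].
    by rewrite sumr_const card_ffun !card_ord expn0.
  by congr F; apply: size0nil; rewrite size_map size_enum_ord.
under eq_bigr => a _ do rewrite IH.
rewrite pair_bigA /=.
pose cons_ffun (x : 'I_N * {ffun 'I_n -> 'I_N}) : {ffun 'I_n.+1 -> 'I_N} :=
  [ffun i => if unlift ord0 i is Some j then x.2 j else x.1].
pose uncons (f : {ffun 'I_n.+1 -> 'I_N}) := (f ord0, [ffun j => f (lift ord0 j)]).
rewrite [RHS](reindex cons_ffun); last first.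
  exists uncons => [[a g] _|f _].
    congr (_, _); first by rewrite ffunE unlift_none.
    by apply/ffunP => j; rewrite !ffunE liftK.
  by apply/ffunP => i; rewrite ffunE; case: unliftP => [j|] -> //=; rewrite ffunE.
apply: eq_bigr => [[a g] _]; congr F.
rewrite enum_ordSl /= ffunE unlift_none -map_comp; congr (_ :: _).
by apply: eq_map => j /=; rewrite ffunE liftK.
Qed.

Lemma coef_sum_Xn (I : finType) (h : I -> nat) m :
  (\sum_i 'X^(h i) : {poly int})`_m = #|[set i | h i == m]|%:R.
Proof.
rewrite coef_sum -sum1_card natr_sum [RHS]big_mkcond /=.
by apply: eq_bigr => i _; rewrite coefXn inE eq_sym; case: eqP.
Qed.

Lemma card_words_cube r t n m : (0 < r)%N -> (0 < t)%N ->
  #|[set w : {ffun 'I_n -> 'I_(r * t).+1} |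
      word_fexc r [seq (w i : nat) | i <- enum 'I_n] == m]| =
  #|[set v : {ffun 'I_n -> 'I_(r * t).+1} | ((\sum_i v i)%N.-1 %/ t)%N == m]|.
Proof.
move=> r0 t0; have := congr1 (fun p : {poly int} => p`_m) (word_sum_fexc 'X r0 t0 n).
rewrite !word_sum_ffun !coef_sum_Xn => /eqP; rewrite eqr_nat => /eqP ->.
apply: eq_card => v; rewrite !inE; congr (_.-1 %/ _ == _)%N.
by rewrite sumnE big_map big_enum.
Qed.

Definition reduce_pair r t n (r_gt0 : (0 < r)%N)
    (x : 'S_n * {ffun 'I_n -> 'I_(r * t).+1}) : colored_perm r n :=
  (x.1, [ffun i => Ordinal (ltn_pmod (x.2 i) r_gt0)]).

(** Group the sorted pairs by permutation and residues modulo [r]; [card_fiber] counts each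
    group. *)
Lemma sum_fexc_bin r t n m : (0 < r)%N -> (0 < t)%N ->
  (\sum_(w : colored_perm r n.+1 | fexc w == m) 'C(t + n.+1 - star_ceil w, n.+1))%N
  = #|[set v : {ffun 'I_n.+1 -> 'I_(r * t).+1} | ((\sum_i v i)%N.-1 %/ t)%N == m]|.
Proof.
move=> r0 t0; rewrite -card_words_cube // -card_sorts_fexc.
rewrite -sum1_card (partition_big (reduce_pair r0) (fun w => fexc w == m)) /=; last first.
  move=> x; rewrite inE => /andP[_ /eqP <-]; apply/eqP.
  rewrite /fexc /pair_fexc; congr (_ * _ + _)%N.
    by apply: eq_card => i; rewrite !inE ffunE.
  by apply: eq_bigr => i _; rewrite ffunE.
apply: eq_bigr => [[s c] /eqP fm]; rewrite -card_fiber // sum1_card.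
rewrite -(card_imset _ (f := fun b => (s, b))); last by move=> b b' [].
apply: eq_card => x; rewrite [RHS]inE; apply/imsetP/andP.
  case=> b; rewrite inE => /andP[sb /forallP cb] ->; split; last first.
    apply/eqP; congr (_, _); apply/ffunP => i; apply: val_inj; rewrite ffunE /=.
    exact/eqP.
  rewrite inE /= sb -fm /fexc /pair_fexc; apply/eqP; congr (_ * _ + _)%N.
    by apply: eq_card => i; rewrite !inE /dvdn (eqP (cb i)).
  by apply: eq_bigr => i _; rewrite (eqP (cb i)).
case: x => s' b; rewrite inE /= => -[/andP[sb _] /eqP[e1 e2]].
rewrite e1 in sb *; exists b => //; rewrite inE sb; apply/forallP => i.
by rewrite -e2 ffunE.
Qed.

(** * Ehrhart polynomial of the multi-hypersimplex *)

(** The last position is never a descent, which leaves room for the color term. *)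
Lemma star_ceil_le r n (w : colored_perm r n) : (0 < n)%N -> (star_ceil w <= n)%N.
Proof.
case: n w => // n w _; rewrite /star_ceil.
suff : (des_star w <= n)%N by case: (0 < _)%N; lia.
rewrite -ltnS /des_star -[X in (_ < X)%N]card_ord -cardsT; apply/proper_card/properP.
split; first exact: finset.subsetT.
exists ord_max; rewrite ?inE //; apply/existsP => -[j /andP[/eqP jn _]].
by have := ltn_ord j; rewrite jn ltnn.
Qed.

Lemma ceil_fdes_star r n (w : colored_perm r n) : (0 < r)%N -> (0 < n)%N ->
  `|Num.ceil ((fdes_star w)%:R / r%:R : rat)|%N = star_ceil w.
Proof.
move=> r0 n0; have r0' : (0 : rat) < r%:R by rewrite ltr0n.
suff -> : Num.ceil ((fdes_star w)%:R / r%:R : rat) = (star_ceil w)%:Z by [].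
have fr : (first_color w < r)%N.
  by rewrite /first_color; case: insubP => [i _ _|]; rewrite ?n0.
apply: ceil_def; rewrite ltr_pdivlMr // ler_pdivrMr // /fdes_star /star_ceil.
rewrite intrB mulrBl mul1r -!pmulrn -natrM ler_nat ltrBlDr -natrD ltr_nat.
by case: posnP; nia.
Qed.

Definition bin_poly (R : numFieldType) n d : {poly R} :=
  (n`!%:R)^-1 *: \prod_(i < n) ('X + ((n - d)%:R - i%:R)%:P).

Lemma bin_polyE (R : numFieldType) n d t : (d <= n)%N ->
  (bin_poly R n d).[t%:R] = 'C(t + n - d, n)%:R.
Proof.
move=> dn; rewrite /bin_poly hornerZ horner_prod.
have -> : \prod_(i < n) ('X + ((n - d)%:R - i%:R)%:P).[t%:R] =
    ((t + n - d) ^_ n)%:R :> R.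
  rewrite -addnBA //; set a := (t + (n - d))%N.
  under eq_bigr => i _ do rewrite hornerD hornerX hornerC addrA -natrD -/a.
  elim: (n) => [|m IH]; first by rewrite big_ord0.
  (* For [a < m] the truncated [a - m] is wrong, but a zero factor has already occurred. *)
  rewrite big_ord_recr /= IH ffactnSr natrM; case: (leqP m a) => ma.
    by rewrite natrB.
  by rewrite ffact_small // !mul0r.
rewrite -bin_ffact natrM mulrCA mulVf ?mulr1 //.
by rewrite pnatr_eq0 -lt0n fact_gt0.
Qed.

Lemma coefM_eq (R : nzRingType) (p q q' : {poly R}) m :
  (forall i, (i <= m)%N -> q`_i = q'`_i) -> (p * q)`_m = (p * q')`_m.
Proof.
by move=> qq'; rewrite !coefM; apply: eq_bigr => i _; rewrite qq' // leq_subr.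
Qed.

(** By Pascal's rule, multiplying the series of ['C(t + n, n)] by [1 - z] lowers [n] by one. [Q]
    truncates this series beyond degree [m], which leaves the coefficients up to [m] unchanged. *)
Lemma coef_one_sub_exp_bin (R : nzRingType) n m :
  \sum_(i < m.+1) ((1 - 'X) ^+ n.+1 : {poly R})`_i * 'C(m - i + n, n)%:R
  = (m == 0%N)%:R.
Proof.
pose Q n0 : {poly R} := \poly_(t < m.+1) 'C(t + n0, n0)%:R.
suff coefQ k : (k <= m)%N -> ((1 - 'X) ^+ n.+1 * Q n)`_k = (k == 0%N)%:R.
  rewrite -(coefQ m) // coefM; apply: eq_bigr => i _.
  by rewrite coef_poly ltnS leq_subr.
move=> km; elim: n k km => [|n IH] k km.
  rewrite expr1 mulrBl mul1r coefB coefXM !coef_poly ltnS km addn0 bin0.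
  by case: k km => [|k] km /=; rewrite ?subr0 // (ltnW _) // addn0 bin0 subrr.
rewrite exprSr -mulrA -(IH k km); apply: coefM_eq => i ik.
have im : (i <= m)%N by apply: leq_trans km.
rewrite mulrBl mul1r coefB coefXM !coef_poly ltnS im.
case: i {ik} im => [|i] im /=; first by rewrite !add0n !binn subr0.
by rewrite (ltnW _) // addSn binS addSnnS natrD addrC addKr.
Qed.

(** ['C(t + n - d, n)] vanishes for [t < d], so its series is that of ['C(t + n, n)] times
    [z ^ d]. *)
Lemma ehrhart_star_bin (R : nzRingType) n d m : (d <= n)%N ->
  \sum_(i < m.+1) ((1 - 'X) ^+ n.+1 : {poly R})`_i * 'C(m - i + n - d, n)%:R
  = (m == d)%:R.
Proof.
move=> dn; case: (ltnP m d) => [md|dm].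
  rewrite ltn_eqF // big1 // => i _; rewrite bin_small ?mulr0 //; lia.
have -> : (m == d) = (m - d == 0)%N by rewrite subn_eq0 eqn_leq dm andbT.
rewrite -(coef_one_sub_exp_bin R n) -(big_mkord xpredT
  (fun i => ((1 - 'X) ^+ n.+1)`_i * 'C(m - i + n - d, n)%:R)).
rewrite (@sum_nat_split _ _ (m - d).+1) //; last by rewrite ltnS leq_subr.
rewrite [X in _ + X]big_nat [X in _ + X]big1 ?addr0 => [|i /andP[di im]]; last first.
  by rewrite bin_small ?mulr0 //; lia.
rewrite big_mkord; apply: eq_bigr => i _; congr (_ * 'C(_, _)%:R).
by have := ltn_ord i; lia.
Qed.

(** * Lattice points of the dilates *)

Local Open Scope classical_set_scope.

Lemma card_eq_fin_image (I : finType) (T : Type) (A : {set I}) (f : I -> T) :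
  injective f -> (f @` [set i | i \in A] #= `I_#|A|)%card.
Proof.
move=> fI; have -> : f @` [set i | i \in A] =
    (f \o (@enum_val _ (mem A))) @` [set: 'I_#|A|].
  apply/seteqP; split=> [_ [i iA <-]|_ [k _ <-]] /=.
    by exists (enum_rank_in iA i) => //=; rewrite enum_rankK_in.
  by exists (enum_val k) => //; exact: enum_valP.
apply: card_eq_trans (card_esym card_II); apply: inj_card_eq => k l _ _ /= /fI.
exact: enum_val_inj.
Qed.

Lemma dilate_row (R : realType) r n k t (a : 'I_n -> nat) :
  (0 < t)%N -> (0 < k)%N ->
  dilate t (multi_hypersimplex R r n k) (\row_i (a i)%:R) <->
  (forall i, (a i <= r * t)%N) /\
  ((k.-1 * t <= \sum_i a i)%N &&
   (if k == (r * n)%N then \sum_i a i <= k * t else \sum_i a i < k * t)%N).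
Proof.
move=> t0 k0; have t0' : (0 : R) < t%:R by rewrite ltr0n.
have kE : k%:R - 1 = k.-1%:R :> R by rewrite -subn1 natrB.
have memE (v : 'rV[R]_n) : t%:R *: v = \row_i (a i)%:R ->
    (forall i, v 0 i = (a i)%:R / t%:R) /\ \sum_i v 0 i = (\sum_i a i)%N%:R / t%:R.
  move=> tv; have vE i : v 0 i = (a i)%:R / t%:R.
    have := congr1 (fun x : 'rV[R]_n => x 0 i) tv; rewrite !mxE => <-.
    by rewrite mulrAC mulfV ?mul1r // gt_eqF.
  by split=> //; rewrite natr_sum mulr_suml; apply: eq_bigr.
split=> [[v [v01 vlo vhi] /memE[vE sE]]|[ale]].
  split=> [i|].
    have := v01 i; rewrite vE => /andP[_].
    by rewrite ler_pdivrMr // -natrM ler_nat.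
  move: vlo vhi; rewrite sE kE ler_pdivlMr // -natrM ler_nat => -> /=.
  by case: ifP => _; rewrite ?ler_pdivrMr ?ltr_pdivrMr // -natrM ?ler_nat ?ltr_nat.
move=> /andP[lo hi]; pose v : 'rV[R]_n := \row_i ((a i)%:R / t%:R).
have tv : t%:R *: v = \row_i (a i)%:R.
  by apply/rowP => i; rewrite !mxE mulrCA mulfV ?mulr1 // gt_eqF.
have [vE sE] := memE v tv; exists v => //; split.
- move=> i; rewrite vE divr_ge0 ?ler0n //=.
  by rewrite ler_pdivrMr // -natrM ler_nat.
- by rewrite sE kE ler_pdivlMr // -natrM ler_nat.
move: hi; rewrite sE.
by case: ifP => _; rewrite ?ler_pdivrMr ?ltr_pdivrMr // -natrM ?ler_nat ?ltr_nat.
Qed.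

Lemma multi_hypersimplex_lattice (R : realType) r n k t : (0 < t)%N ->
  (1 <= k <= r * n)%N ->
  dilate t (multi_hypersimplex R r n k) `&` lattice R n =
  (fun v : {ffun 'I_n -> 'I_(r * t).+1} => \row_i ((r * t - v i)%N%:R : R)) @`
    [set v | v \in [set v : {ffun 'I_n -> 'I_(r * t).+1} |
                     ((\sum_i v i)%N.-1 %/ t)%N == (r * n - k)%N]%SET].
Proof.
move=> t0 /andP[k0 kn].
(* The half-open slab becomes [(r n - k) t < sum v <= (r n - k + 1) t]. For [k = r n] the closed end
   adds [v = 0], which the truncated predecessor also puts in the slab of quotient 0. *)
have slabE (v : {ffun 'I_n -> 'I_(r * t).+1}) :
    ((\sum_i v i)%N.-1 %/ t == r * n - k)%N =
    ((k.-1 * t <= \sum_i (r * t - v i))%N &&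
     (if k == (r * n)%N then \sum_i (r * t - v i) <= k * t
      else \sum_i (r * t - v i) < k * t)%N).
  have sE : (\sum_i (r * t - v i) + \sum_i v i = k * t + (r * n - k) * t)%N.
    rewrite -big_split /= (eq_bigr (fun=> r * t)%N) => [|i _]; last first.
      by rewrite subnK // -ltnS ltn_ord.
    by rewrite sum_nat_const card_ord -mulnDl subnKC // mulnCA mulnA.
  rewrite eqn_leq -ltnS ltn_divLR // leq_divRL // mulSn.
  have -> : (k.-1 * t = k * t - t)%N by rewrite -subn1 mulnBl mul1n.
  have kt : (t <= k * t)%N by rewrite leq_pmull.
  case: eqP => [e|ne].
    by move: sE; rewrite -e subnn mul0n; lia.
  have qt : (t <= (r * n - k) * t)%N by rewrite leq_pmull //; lia.
  by lia.
apply/seteqP; split=> [x [xD [u _ ux]]|_ [v /= vA <-]].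
  have uE i : exists a : 'I_(r * t).+1, x 0 i = a%:R :> R.
    case: xD => v [v01 _ _] vx.
    have := v01 i; have xi : x 0 i = (u 0 i)%:~R by rewrite -ux mxE.
    have vi : x 0 i = t%:R * v 0 i by rewrite -vx mxE.
    have t0' : (0 : R) < t%:R by rewrite ltr0n.
    rewrite -(ler_pM2l t0') -(ler_pM2l t0' (v 0 i)) -vi mulr0 xi => /andP[].
    rewrite ler0z; case: (u 0 i) => // m _.
    rewrite -pmulrn -natrM ler_nat mulnC => mrt.
    by exists (Ordinal (mrt : (m < (r * t).+1)%N)).
  have [a aE] := fin_all_exists uE.
  have xE : x = \row_i (a i)%:R by apply/rowP => i; rewrite aE mxE.
  have rev_aE i : (r * t - rev_ord (a i) = a i)%N.
    by rewrite /= subSS subKn // -ltnS ltn_ord.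
  exists [ffun i => rev_ord (a i)]; last first.
    by rewrite xE; apply/rowP => i; rewrite !mxE ffunE rev_aE.
  rewrite /= finset.inE slabE.
  rewrite (eq_bigr (fun i => a i : nat)) => [|i _]; last by rewrite ffunE rev_aE.
  by move: xD; rewrite xE; move/dilate_row => /(_ t0 k0)[].
move: vA; rewrite finset.inE slabE => vA; split.
  by apply/dilate_row => //; split=> // i; rewrite leq_subr.
exists (\row_i (r * t - v i)%N%:Z) => //.
by apply/rowP => i; rewrite !mxE.
Qed.

Local Close Scope classical_set_scope.

Theorem theorem4p5 (R : realType) (r n k : nat) :
  (1 <= r)%N -> (1 <= n)%N -> (1 <= k <= r * n)%N ->
  exists E : {poly R},
    is_ehrhart_poly (multi_hypersimplex R r n k) E /\
    forall m : nat,
      ehrhart_star n E m =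
      (\sum_(w : colored_perm r n | fexc w == (r * n - k)%N)
          'X^(`|Num.ceil ((fdes_star w)%:R / r%:R : rat)|%N) : {poly R})`_m.
Proof.
move=> r0 n0 k_range.
(* By [ehrhart_star_bin], the summand of [w] contributes the single monomial of degree
   [star_ceil w]. *)
pose E : {poly R} := \sum_(w : colored_perm r n | fexc w == (r * n - k)%N)
  bin_poly R n (star_ceil w).
have evalE t : E.[t%:R] = \sum_(w : colored_perm r n | fexc w == (r * n - k)%N)
    'C(t + n - star_ceil w, n)%:R.
  by rewrite horner_sum; apply: eq_bigr => w _; rewrite bin_polyE ?star_ceil_le.
exists E; split=> [t t0|m].
  pose A := [set v : {ffun 'I_n -> 'I_(r * t).+1} |
    ((\sum_i v i)%N.-1 %/ t)%N == (r * n - k)%N].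
  exists #|A|.
    rewrite multi_hypersimplex_lattice //; apply: card_eq_fin_image => v v' /rowP e.
    apply/ffunP => i; apply: val_inj; have := e i; rewrite !mxE => /eqP.
    have le (u : 'I_(r * t).+1) : (u <= r * t)%N by rewrite -ltnS ltn_ord.
    by rewrite eqr_nat => /eqP e'; rewrite /= -(subKn (le (v i))) e' subKn.
  rewrite evalE -natr_sum; congr _%:R.
  by move: n0 @A {k_range E evalE}; case: n => // n' _; rewrite sum_fexc_bin.
rewrite /ehrhart_star /fps_mul coef_sum.
under eq_bigr => i _ do rewrite evalE mulr_sumr.
rewrite exchange_big; apply: eq_bigr => w _ /=.
by rewrite ceil_fdes_star // coefXn ehrhart_star_bin // star_ceil_le.
Qed.
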